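(* Let $q$ be a prime power, $n\ge 1$, and let $Q^+(2n+1,q)$ be a non-degenerate hyperbolic quadric in ${\rm PG}(2n+1,q)$. Fix a generator $\Pi$ of $Q^+(2n+1,q)$. Let $\mathcal G_n$ be the graph whose vertices are the points of $Q^+(2n+1,q)\setminus\Pi$, two distinct vertices $P_1,P_2$ being adjacent if and only if either the line $\langle P_1,P_2\rangle$ is secant to $Q^+(2n+1,q)$ (meets it in exactly two points), or the line $\langle P_1,P_2\rangle$ is contained in $Q^+(2n+1,q)$ and meets $\Pi$ in a point. Then $\mathcal G_n$ is a strongly regular graph with parameters $v=\frac{q^n(q^{n+1}-1)}{q-1}$, $k=q^{2n}-1$, $\lambda=q^{2n-1}(q-1)-2$, $\mu=(q^{2n-1}+q^{n-1})(q-1)$.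
   Context: A generator of $Q^+(2n+1,q)$ is a projective subspace of maximal dimension (namely $n$) contained in the quadric. A strongly regular graph with parameters $(v,k,\lambda,\mu)$ is a $k$-regular graph on $v$ vertices in which any two adjacent vertices have exactly $\lambda$ common neighbours and any two non-adjacent vertices have exactly $\mu$ common neighbours. *)

(* Defs.v *)
From HB Require Import structures.
From mathcomp Require Import all_boot all_algebra.

Set Implicit Arguments.
Unset Strict Implicit.
Unset Printing Implicit Defensive.

Import GRing.Theory.
Local Open Scope ring_scope.

HB.instance Definition _ (F : finFieldType) (vT : vectType F) :=
  CanIsCountable (@VectorInternalTheory.vs2mxK F vT).
HB.instance Definition _ (F : finFieldType) (vT : vectType F) :
    isFinite {vspace vT} := CanIsFinite (@VectorInternalTheory.vs2mxK F vT).

(* PG(N - 1, q) is the projective space of F^N with #|F| = q: a projective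
   subspace of dimension d is a {vspace 'rV[F]_N} of dimension d + 1. *)
Section Quadric.
Variables (F : finFieldType) (N : nat).
Implicit Types (A : 'M[F]_N) (U L P Pi : {vspace 'rV[F]_N}).

Definition points U : {set {vspace 'rV[F]_N}} :=
  [set P | \dim P == 1%N & (P <= U)%VS].

(* Every quadratic form on F^N, in any characteristic, is of this shape;
   A is not required to be symmetric. *)
Definition qform A (x : 'rV[F]_N) : F := \sum_i \sum_j A i j * x 0 i * x 0 j.

Definition polar A (x y : 'rV[F]_N) : F :=
  qform A (x + y) - qform A x - qform A y.

Definition quadric A : {set {vspace 'rV[F]_N}} :=
  [set P in points fullv | [forall x : 'rV[F]_N, (x \in P) ==> (qform A x == 0)]].

(* No singular point; in odd characteristic the first premise is redundant,
   in characteristic 2 it is not. *)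
Definition nondegenerate_quadric A : Prop :=
  forall x, qform A x = 0 -> (forall y, polar A x y = 0) -> x = 0.

Definition contained A U : bool := points U \subset quadric A.

Definition secant A L : bool := #|quadric A :&: points L| == 2%N.

Definition quadric_generator A Pi : Prop :=
  contained A Pi /\ forall U, contained A U -> (\dim U <= \dim Pi)%N.

Definition vertices A Pi : {set {vspace 'rV[F]_N}} := quadric A :\: points Pi.

Definition adj A Pi : rel {P | P \in vertices A Pi} :=
  fun P1 P2 : {P | P \in vertices A Pi} =>
  let L := (val P1 + val P2)%VS in
  (P1 != P2) &&
  (secant A L || (contained A L && (\dim (L :&: Pi) == 1%N))).

End Quadric.

Arguments adj {F N} A Pi.

(* The non-degenerate quadrics of PG(2n + 1, q) whose generators have
   projective dimension n. *)
Definition hyperbolic (F : finFieldType) (n : nat) (A : 'M[F]_(2 * n + 2)) : Prop :=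
  nondegenerate_quadric A /\ exists2 U, quadric_generator A U & \dim U = n.+1.

Definition strongly_regular (V : finType) (e : rel V) (v k l m : nat) : Prop :=
  [/\ symmetric e /\ irreflexive e,
      #|V| = v,
      forall x, #|[set y | e x y]| = k,
      forall x y, e x y -> #|[set z | e x z && e y z]| = l
    & forall x y, x != y -> ~~ e x y -> #|[set z | e x z && e y z]| = m].

(* Main.v *)
Require Import Defs.
From mathcomp Require Import all_boot all_algebra.
From HB Require Import structures.
From mathcomp Require Import finfield zify ring.

(* Adjacency is the complement of the relation "B x y = 0 and y is not in
   Pi + <x>" between distinct points <x>, <y>, where B is the polar form; this
   complement is what gets counted, in nonzero vectors rather than points.
   Since Pi is totally singular of half the dimension, its orthogonal is Pi
   itself.  Hence for T = Pi + <x, ...> the subspace U = Pi :&: {x, ...}^perp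
   has orthogonal T, and translating a vector z outside T by U makes Q z run
   uniformly over F.  So exactly 1/q of the vectors of {x, ...}^perp outside T
   are singular, which reduces every count to cardinals of subspaces; the
   common non-neighbours inside T are treated by hand. *)

Set Implicit Arguments.
Unset Strict Implicit.
Unset Printing Implicit Defensive.

Import GRing.Theory.
Local Open Scope ring_scope.

(** * Quadratic and polar forms, and equidistribution under translation *)

Section QuadraticForm.
Variables (F : finFieldType) (N : nat) (A : 'M[F]_N).
Implicit Types (x y z u : 'rV[F]_N) (U T : {vspace 'rV[F]_N}).
Local Notation Q := (qform A).
Local Notation B := (polar A).
Local Notation q := #|F|.

Lemma qformE x : Q x = (x *m A *m x^T) 0 0.
Proof.
rewrite /qform !mxE exchange_big; apply: eq_bigr => j _.
rewrite !mxE big_distrl; apply: eq_bigr => i _ /=.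
by rewrite [A i j * _]mulrC.
Qed.

Lemma polarE x y : B x y = (x *m (A + A^T) *m y^T) 0 0.
Proof.
have -> : x *m (A + A^T) *m y^T = x *m A *m y^T + (y *m A *m x^T)^T.
  by rewrite mulmxDr mulmxDl !trmx_mul trmxK mulmxA.
rewrite /polar !qformE linearD /= !mulmxDl !mulmxDr !mxE.
by ring.
Qed.

Lemma polarC x y : B x y = B y x.
Proof. by rewrite /polar [x + y]addrC addrAC. Qed.

Fact polar_linear x : linear (B x : 'rV[F]_N -> F^o).
Proof.
move=> a y z.
by rewrite !polarE linearP /= mulmxDr -scalemxAr !mxE.
Qed.
HB.instance Definition _ x :=
  GRing.isLinear.Build F 'rV[F]_N F^o *:%R (B x) (polar_linear x).

Lemma polarDl x y z : B (x + y) z = B x z + B y z.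
Proof. by rewrite polarC linearD /= !(polarC z). Qed.
Lemma polarZl a x z : B (a *: x) z = a * B x z.
Proof. by rewrite polarC linearZ /= polarC. Qed.
Lemma polarDr x y z : B x (y + z) = B x y + B x z.
Proof. by rewrite linearD. Qed.
Lemma polarZr a x z : B x (a *: z) = a * B x z.
Proof. by rewrite linearZ. Qed.
Lemma qformD x y : Q (x + y) = Q x + Q y + B x y.
Proof. by rewrite /polar; ring. Qed.
Lemma qformZ a x : Q (a *: x) = a ^+ 2 * Q x.
Proof. by rewrite !qformE linearZ /= -!scalemxAl -scalemxAr !mxE mulrA. Qed.
Lemma qform0 : Q 0 = 0.
Proof. by rewrite -(scale0r 0) qformZ expr0n mul0r. Qed.
Lemma polarxx x : B x x = 2%:R * Q x.
Proof. by rewrite /polar -mulr2n -scaler_nat qformZ; ring. Qed.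

Definition perp x : {vspace 'rV[F]_N} := lker (linfun (B x : 'rV[F]_N -> F^o)).

Lemma memv_perp x y : (y \in perp x) = (B x y == 0).
Proof. by rewrite memv_ker lfunE. Qed.

(** Translation by a suitable multiple of a vector of [U] off the kernel of [f] injects any fibre of
    [f] on [U] into any other, so all q fibres have the same size. *)
Lemma card_fiber U (f : {linear 'rV[F]_N -> F^o}) (c : F^o) :
  (exists2 u, u \in U & f u != 0) ->
  (q * #|[set u in U | f u == c]| = #|U|)%N.
Proof.
case=> u0 Uu0 fu0.
have le_fib a b : (#|[set u in U | f u == a]| <= #|[set u in U | f u == b]|)%N.
  rewrite -(card_imset _ (addIr (((b - a) / f u0) *: u0))).
  apply/subset_leq_card/subsetP=> _ /imsetP[u /[!inE] /andP[Uu /eqP fu] ->].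
  rewrite memvD ?memvZ //= linearD linearZ /= fu /GRing.scale /=.
  by rewrite divfK // addrC subrK.
rewrite -[RHS]sum1_card (partition_big f xpredT) //=.
rewrite (eq_bigr (fun=> #|[set u in U | f u == c]|)) ?sum_nat_const // => d _.
by rewrite sum1dep_card; apply/eqP; rewrite eqn_leq !le_fib.
Qed.

Lemma card_cap_perp U x : (exists2 u, u \in U & B x u != 0) ->
  (q * #|(U :&: perp x)%VS| = #|U|)%N.
Proof.
move=> /(@card_fiber _ (B x : 'rV[F]_N -> F^o) 0) <-; congr (_ * _)%N.
by apply: eq_card => z; rewrite memv_cap memv_perp !inE.
Qed.

(* Translation by u changes Q z by B z u, which is equidistributed for u in
   U; so Q takes the value 0 on the proportion 1/q of D. *)
Lemma card_singular_translates U (D : {set 'rV[F]_N}) :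
    {in U, forall u, Q u = 0} ->
    (forall z u, z \in D -> u \in U -> z + u \in D) ->
    {in D, forall z, exists2 u, u \in U & B z u != 0} ->
  (q * #|[set z in D | Q z == 0%R]| = #|D|)%N.
Proof.
move=> QU DU ndD; have U_gt0 : (0 < #|U|)%N.
  by apply/card_gt0P; exists 0; rewrite mem0v.
apply/eqP; rewrite -(eqn_pmul2r U_gt0) -mulnA; apply/eqP.
(* Double counting of the pairs (z, u) with [Q (z + u) = 0]. For fixed u, translation by u permutes
   [D]; for fixed z, [Q (z + u) = Q z + B z u], so the admissible u form one fibre of [B z] on
   [U]. *)
have <- : (\sum_(z in D) \sum_(u in U) (Q (z + u)%R == 0%R) =
           #|[set z in D | Q z == 0%R]| * #|U|)%N.
  rewrite exchange_big [RHS]mulnC -sum_nat_const; apply: eq_bigr => u Uu.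
  rewrite -sum1_card big_mkcond [RHS]big_mkcond.
  rewrite [RHS](reindex_inj (addIr u)); apply: eq_bigr => z _ /=.
  rewrite inE; have -> : (z + u \in D) = (z \in D); last by case: ifP.
  apply/idP/idP=> [Dzu|Dz]; last exact: DU.
  by rewrite -(addrK u z) DU // memvN.
rewrite big_distrr -sum_nat_const; apply: eq_bigr => z Dz.
rewrite -(card_fiber (f := B z : 'rV[F]_N -> F^o) (- Q z) (ndD z Dz)) /=.
congr (_ * _)%N; rewrite -sum1_card big_mkcond [RHS]big_mkcond.
apply: eq_bigr => u _ /=; rewrite inE; case: ifP => //= Uu.
by rewrite qformD (QU u Uu) addr0 addrC addr_eq0; case: ifP.
Qed.

(* The orthogonal of U is contained in T. *)
Definition perp_sub U T := forall z, {in U, forall u, B z u = 0} -> z \in T.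

Lemma perp_sub_ex U T z : perp_sub U T -> z \notin T ->
  exists2 u, u \in U & B z u != 0.
Proof.
move=> UT; have [/exists_inP[u Uu zu] _|] := boolP [exists u in U, B z u != 0].
  by exists u.
move/exists_inPn => noU /negP[]; apply: UT => u Uu.
by apply/eqP/negbNE/noU.
Qed.

(** A functional [B z] on [U] that vanishes on the kernel of [B x] is a multiple of [B x].
    Subtracting the corresponding multiple of [x] from [z] therefore gives a vector orthogonal to
    all of [U]. *)
Lemma perp_sub_step U T x : perp_sub U T -> x \notin T ->
  perp_sub (U :&: perp x)%VS (T + <[x]>)%VS.
Proof.
move=> UT nTx z zU.
have [p Up xp] := perp_sub_ex UT nTx.
(* [a] makes [z - a *: x] orthogonal to [p]; below, [c] makes [u - c *: p] orthogonal to [x]. *)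
pose a := B z p / B x p.
rewrite -(subrK (a *: x) z) memv_add ?memvZ ?memv_line //.
apply: UT => u Uu; pose c := B x u / B x p.
have /zU : u - c *: p \in (U :&: perp x)%VS.
  rewrite memv_cap memvB ?memvZ //= memv_perp linearB linearZ /= /c.
  by rewrite /GRing.scale /= divfK // subrr.
rewrite linearB linearZ /= /GRing.scale /= => /eqP; rewrite subr_eq0 => /eqP zu.
rewrite polarDl -scaleN1r !polarZl zu /c /a.
by field.
Qed.

Lemma card_add_line U x : x \notin U -> #|(U + <[x]>)%VS| = (q * #|U|)%N.
Proof.
move=> nUx; rewrite !card_vspace dimv_disjoint_sum ?dim_vline.
  rewrite (_ : x != 0) ?expnD ?expn1 1?mulnC //.
  by apply: contraNneq nUx => ->; rewrite mem0v.
apply/eqP; rewrite -subv0; apply/subvP=> v; rewrite memv_cap.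
case/andP=> Uv /vlineP[k vE]; rewrite memv0 vE scaler_eq0.
apply: contraNT nUx; rewrite negb_or => /andP[k0 _].
by rewrite -(scalerK k0 x) -vE memvZ.
Qed.

End QuadraticForm.

Lemma mem_add_lineP (F : fieldType) (vT : vectType F) (U : {vspace vT}) x z :
  reflect (exists k, z - k *: x \in U) (z \in (U + <[x]>)%VS).
Proof.
apply: (iffP memv_addP) => [[u Uu [_ /vlineP[k ->] ->]]|[k Uz]].
  by exists k; rewrite addrK.
by exists (z - k *: x) => //; exists (k *: x); rewrite ?memvZ ?memv_line ?subrK.
Qed.

(** Exchange property modulo [U]: the coefficient of [y] in [x] is nonzero because [x] is not in
    [U], hence invertible. *)
Lemma mem_add_lineC (F : fieldType) (vT : vectType F) (U : {vspace vT}) x y :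
  x \notin U -> x \in (U + <[y]>)%VS -> y \in (U + <[x]>)%VS.
Proof.
move=> nUx /mem_add_lineP[k Ux].
have k0 : k != 0 by apply: contraNneq nUx => k0; rewrite k0 scale0r subr0 in Ux.
apply/mem_add_lineP; exists k^-1.
by rewrite -opprB -[y in X in - X](scalerK k0) -scalerBr rpredN memvZ.
Qed.

(** * Counting singular vectors relative to a self-orthogonal totally singular subspace *)

Section Generator.
Variables (F : finFieldType) (N : nat) (A : 'M[F]_N).
Implicit Types (x y z u : 'rV[F]_N) (U E T : {vspace 'rV[F]_N}).
Local Notation Q := (qform A).
Local Notation B := (polar A).
Local Notation perp := (perp A).
Local Notation q := #|F|.

(** Since [U] lies in both [E] and [T], translation by [U] preserves the part of [E] outside [T],
    and no vector there is orthogonal to [U]. Below, [E] is an intersection of hyperplanes [perp x]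
    and [T] is [Pi] plus the corresponding lines. *)
Lemma card_singular_outside U E T :
    {in U, forall u, Q u = 0} -> (U <= E)%VS -> (U <= T)%VS ->
    perp_sub A U T ->
  (q * #|[set z | [&& z \in E, z \notin T & Q z == 0%R]]| + #|(E :&: T)%VS|
   = #|E|)%N.
Proof.
move=> QU /subvP UE /subvP UT pUT; pose D := [set z in E | z \notin T].
have -> : [set z | [&& z \in E, z \notin T & Q z == 0]] = [set z in D | Q z == 0].
  by apply/setP=> z; rewrite !inE andbA.
rewrite (card_singular_translates QU); first last.
- by move=> z; rewrite inE => /andP[_]; apply: perp_sub_ex.
- move=> z u; rewrite !inE => /andP[Ez nTz] Uu; rewrite (memvD Ez (UE _ Uu)) /=.
  by apply: contra nTz => Tzu; rewrite -(addrK u z) (memvB Tzu (UT _ Uu)).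
rewrite -[RHS](cardID (mem T)) addnC; congr (_ + _)%N.
  by apply: eq_card => z; rewrite !inE memv_cap.
by apply: eq_card => z; rewrite !inE andbC.
Qed.

Variable Pi : {vspace 'rV[F]_N}.
Hypothesis singPi : {in Pi, forall u, Q u = 0}.
Hypothesis perpPi : perp_sub A Pi Pi.
Hypothesis perpV : perp_sub A fullv 0%VS.

Lemma polar_sing x y : Q x = 0 -> Q y = 0 -> Q (x + y) = 0 -> B x y = 0.
Proof. by rewrite /polar => -> -> ->; rewrite !subr0. Qed.

Lemma polar_Pi : {in Pi &, forall u v, B u v = 0}.
Proof. by move=> u v Pu Pv; rewrite polar_sing ?singPi ?memvD. Qed.

Lemma F_gt0 : (0 < q)%N.
Proof. by apply/card_gt0P; exists 0. Qed.

Definition outer := [set z | (Q z == 0) && (z \notin Pi)].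
(** These vectors span the points distinct from and not adjacent to the point of [x]. Removing [Pi +
    <[x]>] discards at once [Pi], the point of [x] itself, and the points joined to it by a singular
    line that meets [Pi]. *)
Definition far x := [set z | [&& Q z == 0, B x z == 0 & z \notin (Pi + <[x]>)%VS]].

Lemma card_outer : (q * #|outer| + #|Pi| = #|{: 'rV[F]_N}%VS|)%N.
Proof.
have := card_singular_outside singPi (subvf Pi) (subvv Pi) perpPi.
rewrite capfv => <-; congr (_ * _ + _)%N.
by apply: eq_card => z; rewrite !inE memvf andbC.
Qed.

Lemma card_perp x : x != 0 -> (q * #|perp x| = #|{: 'rV[F]_N}%VS|)%N.
Proof.
move=> x0; rewrite -(card_cap_perp (A := A) (U := fullv) (x := x)) ?capfv //.
by apply: perp_sub_ex perpV _; rewrite memv0.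
Qed.

Lemma notin_neq0 x : x \notin Pi -> x != 0.
Proof. by apply: contraNneq => ->; rewrite mem0v. Qed.

Lemma card_add_line_perp x : x \notin Pi ->
  #|((Pi + <[x]>) :&: perp x)%VS| = #|Pi|.
Proof.
move=> nPx; apply/eqP; rewrite -(eqn_pmul2l F_gt0) card_cap_perp.
  by rewrite card_add_line.
have [u Pu xu] := perp_sub_ex perpPi nPx.
by exists u => //; rewrite (subvP (addvSl _ _)).
Qed.

Lemma card_far x : x \notin Pi -> Q x = 0 ->
  (q * (q * #|far x| + #|Pi|) = #|{: 'rV[F]_N}%VS|)%N.
Proof.
move=> nPx Qx; rewrite -(card_perp (notin_neq0 nPx)).
have pU : perp_sub A (Pi :&: perp x)%VS (Pi + <[x]>)%VS := perp_sub_step perpPi nPx.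
rewrite -(card_singular_outside _ (capvSr Pi (perp x)) _ pU).
- rewrite capvC card_add_line_perp //; congr (_ * (_ * _ + _))%N.
  by apply: eq_card => z; rewrite !inE memv_perp andbC andbA.
- by move=> u; rewrite memv_cap => /andP[/singPi].
- exact: subv_trans (capvSl _ _) (addvSl _ _).
Qed.

Lemma card_perp2 x y : x != 0 -> y \notin <[x]>%VS ->
  (q * (q * #|(perp x :&: perp y)%VS|) = #|{: 'rV[F]_N}%VS|)%N.
Proof.
move=> x0 nxy; rewrite -(card_perp x0) card_cap_perp //.
(* Starting from the trivial radical, one step shows that the orthogonal of [perp x] lies in
   [<[x]>]. *)
have := perp_sub_step perpV (x := x); rewrite memv0 capfv add0v => /(_ x0) pUT.
exact: perp_sub_ex pUT nxy.
Qed.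

(** Here [Pi + <[x]>] and [Pi + <[y]>] are the same subspace, so a single exclusion remains. As [y]
    is a multiple of [x] modulo [Pi], the translations by [Pi :&: perp x] also preserve [perp y]. *)
Lemma card_far_collinear x y : x \notin Pi -> y \notin Pi ->
    y \notin <[x]>%VS -> y \in (Pi + <[x]>)%VS -> Q x = 0 -> B x y = 0 ->
  (q * (q * (q * #|far x :&: far y| + #|Pi|)) = #|{: 'rV[F]_N}%VS|)%N.
Proof.
move=> nPx nPy nxy xPy Qx Bxy; have /mem_add_lineP[k Pk] := xPy.
have Byz z : B y z = B (y - k *: x) z + k * B x z.
  by rewrite -polarZl -polarDl subrK.
have eT : (Pi + <[y]> = Pi + <[x]>)%VS.
  apply/eqP; rewrite eqEsubv !subv_add !addvSl -!memvE xPy.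
  exact: mem_add_lineC.
have pUT := perp_sub_step perpPi nPx.
rewrite -(card_perp2 (notin_neq0 nPx) nxy) -(card_add_line_perp nPx).
(* Inside [Pi + <[x]>], orthogonality to [x] already implies orthogonality to [y]. *)
have cE : ((perp x :&: perp y) :&: (Pi + <[x]>) = (Pi + <[x]>) :&: perp x)%VS.
  apply/vspaceP=> z; rewrite !memv_cap !memv_perp.
  have [/eqP Bxz|_] /= := boolP (B x z == 0); last by rewrite andbF.
  rewrite andbT andbC; have [/mem_add_lineP[m Pm] /=|//] := boolP (z \in _).
  rewrite Byz Bxz mulr0 addr0 -(subrK (m *: x) z) polarDr polar_Pi // add0r.
  have Bxx : B x x = 0 by rewrite polarxx Qx mulr0.
  rewrite polarZr polarDl (polarC A y) Bxy -scaleNr polarZl Bxx.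
  by rewrite mulr0 addr0 mulr0 eqxx.
congr (_ * (_ * _))%N; apply: etrans (card_singular_outside _ _ _ pUT).
- rewrite cE; congr (_ * _ + _)%N; apply: eq_card => z.
  rewrite !inE eT memv_cap !memv_perp.
  by case: (Q z == 0); case: (B x z == 0); case: (B y z == 0); case: (_ \in _).
- by move=> u; rewrite memv_cap => /andP[/singPi].
- apply/subvP=> u; rewrite !memv_cap !memv_perp => /andP[Pu /eqP Bxu].
  by rewrite Bxu Byz Bxu polar_Pi // mulr0 addr0 eqxx.
- exact: subv_trans (capvSl _ _) (addvSl _ _).
Qed.

Let plane x y := ((Pi + <[x]>) + <[y]>)%VS.
(** The generic part of the common non-neighbours, to which the translation argument applies. *)
Let outside x y :=
  [set z | [&& z \in (perp x :&: perp y)%VS, z \notin plane x y & Q z == 0]].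

(** Since [x] and [y] are independent modulo [Pi], which contains its own orthogonal, [B x] and
    [B y] are independent functionals on [Pi], hence on any [U] above it: codimension two. *)
Lemma card_cap_perp2 U x y : x \notin Pi -> y \notin (Pi + <[x]>)%VS ->
  (Pi <= U)%VS -> (q * (q * #|(U :&: (perp x :&: perp y))%VS|) = #|U|)%N.
Proof.
move=> nPx nPy PU; have pUT := perp_sub_step perpPi nPx.
rewrite capvA card_cap_perp; last first.
  have [u Uu yu] := perp_sub_ex pUT nPy.
  by exists u => //; rewrite (subvP (capvS PU (subvv _))) //.
rewrite card_cap_perp //; have [u Pu xu] := perp_sub_ex perpPi nPx.
by exists u => //; rewrite (subvP PU).
Qed.

Lemma card_plane x y : x \notin Pi -> y \notin (Pi + <[x]>)%VS ->
  #|(plane x y :&: (perp x :&: perp y))%VS| = #|Pi|.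
Proof.
move=> nPx nPy; have Pp : (Pi <= plane x y)%VS by rewrite /plane -addvA addvSl.
have := card_cap_perp2 nPx nPy Pp.
rewrite !card_add_line // => /eqP.
by rewrite !(eqn_pmul2l F_gt0) => /eqP.
Qed.

Lemma card_outside x y : x \notin Pi -> y \notin (Pi + <[x]>)%VS ->
  (q * (q * (q * #|outside x y| + #|Pi|)) = #|{: 'rV[F]_N}%VS|)%N.
Proof.
move=> nPx nPy; have pUT := perp_sub_step (perp_sub_step perpPi nPx) nPy.
have nxy : y \notin <[x]>%VS by apply: contra nPy; apply/subvP/addvSr.
rewrite -(card_perp2 (notin_neq0 nPx) nxy) -(card_plane nPx nPy) capvC.
congr (_ * (_ * _))%N; apply: etrans (card_singular_outside _ _ _ pUT) => //.
- by move=> u; rewrite memv_cap => /andP[/memv_capP[/singPi]].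
- by rewrite -capvA capvSr.
- by rewrite -!capvA -addvA (subv_trans (capvSl _ _)) ?addvSl.
Qed.

(** [plane x y] contains both excluded subspaces, so off it the exclusions are automatic; only its
    own vectors need a separate treatment. *)
Lemma far_sub_lines x y z : x \notin Pi -> y \notin (Pi + <[x]>)%VS ->
  (z \in far x :&: far y) = (z \in outside x y) ||
    [&& z \in (plane x y :&: (perp x :&: perp y))%VS, z \notin (Pi + <[x]>)%VS,
     z \notin (Pi + <[y]>)%VS & Q z == 0].
Proof.
move=> nPx nPy; rewrite !inE !memv_cap !memv_perp.
case: (Q z == 0); rewrite ?andbF //=.
case: (B x z == 0); rewrite ?andbF //=.
case: (B y z == 0); rewrite ?andbF //= !andbT.
have [//|nT] /= := boolP (z \in plane x y).
have Tx : (Pi + <[x]> <= plane x y)%VS by rewrite /plane addvSl.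
have Ty : (Pi + <[y]> <= plane x y)%VS.
  by rewrite /plane -addvA [(<[x]> + _)%VS]addvC addvA addvSl.
by rewrite (contra (subvP Tx z)) ?(contra (subvP Ty z)).
Qed.

(** Orthogonality to [x] and [y] forces [B x p = - b * B x y] and [B y p = - a * B x y]. The three
    cross terms of the expansion are then -ab, -ab and +ab times [B x y]. *)
Lemma qform_plane a b p x y : Q x = 0 -> Q y = 0 -> p \in Pi ->
    B x (p + a *: x + b *: y) = 0 -> B y (p + a *: x + b *: y) = 0 ->
  Q (p + a *: x + b *: y) = - (a * b * B x y).
Proof.
move=> Qx Qy Pp; rewrite !polarDr !polarZr !polarxx Qx Qy !mulr0 !addr0.
move=> /eqP; rewrite addr_eq0 => /eqP Bxp /eqP; rewrite addr_eq0 => /eqP Byp.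
rewrite !qformD !qformZ Qx Qy singPi // !polarDl !polarZr !polarZl.
rewrite (polarC A p x) (polarC A p y) Bxp Byp (polarC A y x).
by ring.
Qed.

(** By [qform_plane], a singular vector of the plane orthogonal to [x] and [y] has ab = 0, so it
    lies in an excluded subspace: only [outside] contributes. *)
Lemma card_far_opposite x y : x \notin Pi -> y \notin (Pi + <[x]>)%VS ->
    Q x = 0 -> Q y = 0 -> B x y != 0 ->
  (q * (q * (q * #|far x :&: far y| + #|Pi|)) = #|{: 'rV[F]_N}%VS|)%N.
Proof.
move=> nPx nPy Qx Qy Bxy; rewrite -(card_outside nPx nPy).
congr (_ * (_ * (_ * _ + _)))%N; apply: eq_card => z; rewrite far_sub_lines //.
case: (z \in outside x y) => //=; apply/negP => /and4P[].
rewrite memv_cap => /andP[/mem_add_lineP[b /mem_add_lineP[a Pp]]].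
rewrite memv_cap !memv_perp => /andP[Bxz Byz] nzx nzy Qz.
have zE : z = (z - b *: y - a *: x) + a *: x + b *: y by rewrite !subrK.
move: Qz Bxz Byz; rewrite zE => + /eqP Bxz /eqP Byz.
rewrite (qform_plane Qx Qy Pp Bxz Byz) oppr_eq0 !mulf_eq0 (negPf Bxy) orbF.
case/orP=> /eqP k0; move: Pp; rewrite k0 scale0r subr0 => Pz.
  by case/negP: nzy; apply/mem_add_lineP; exists b.
by case/negP: nzx; apply/mem_add_lineP; exists a.
Qed.

(** When [B x y = 0], every vector of the plane orthogonal to [x] and [y] is singular, so the plane
    contributes all of them off the two excluded subspaces. Inclusion-exclusion gives |Pi| - 2|Pi|/q
    + |Pi|/q^2; one more q^2 |Pi| comes from [card_outside], whence the coefficient 3. *)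
Lemma card_far_tangent x y : x \notin Pi -> y \notin (Pi + <[x]>)%VS ->
    Q x = 0 -> Q y = 0 -> B x y = 0 ->
  (q ^ 3 * #|far x :&: far y| + 3 * q ^ 2 * #|Pi| =
   #|{: 'rV[F]_N}%VS| + q ^ 3 * #|Pi| + q * #|Pi|)%N.
Proof.
move=> nPx nPy Qx Qy Bxy; rewrite -(card_outside nPx nPy).
pose E := (perp x :&: perp y)%VS.
have nPy' : y \notin Pi by apply: contra nPy; apply/subvP/addvSl.
have nPx' : x \notin (Pi + <[y]>)%VS.
  by apply: contra nPy => Pyx; exact: mem_add_lineC.
have c0 := card_cap_perp2 nPx nPy (subvv Pi).
have c1 := card_cap_perp2 nPx nPy (addvSl Pi <[x]>).
have c2 := card_cap_perp2 nPx nPy (addvSl Pi <[y]>).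
have c3 := card_plane nPx nPy.
pose X := [set z in E | [&& z \in plane x y, z \notin (Pi + <[x]>)%VS &
                         z \notin (Pi + <[y]>)%VS]].
pose X0 := [set z in (Pi :&: E)%VS].
pose X1 := [set z in ((Pi + <[x]>) :&: E)%VS].
pose X2 := [set z in ((Pi + <[y]>) :&: E)%VS].
pose X3 := [set z in (plane x y :&: E)%VS].
have sing3 z : z \in X3 -> Q z = 0.
  rewrite inE memv_cap => /andP[/mem_add_lineP[b /mem_add_lineP[a Pp]]].
  rewrite memv_cap !memv_perp => /andP[].
  have zE : z = (z - b *: y - a *: x) + a *: x + b *: y by rewrite !subrK.
  rewrite zE => /eqP Bxz /eqP Byz.
  by rewrite (qform_plane Qx Qy Pp Bxz Byz) Bxy mulr0 oppr0.
have farE : #|far x :&: far y| = (#|outside x y| + #|X|)%N.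
  rewrite -cardsUI [outside x y :&: X](_ : _ = set0) ?cards0 ?addn0; last first.
    by apply/setP=> z; rewrite !inE; case: (z \in plane x y); rewrite ?andbF.
  apply: eq_card => z; rewrite far_sub_lines // in_setU; congr (_ || _).
  rewrite [z \in X]inE memv_cap -andbA -/E.
  case: (boolP (z \in plane x y)); last by rewrite andbF.
  case: (boolP (z \in E)) => //= Ez Tz; rewrite sing3 ?eqxx ?andbT //.
  by rewrite inE memv_cap Ez Tz.
have sub1 : X1 \subset X3.
  apply/subsetP=> z; rewrite !inE !(memv_cap _ _ E) => /andP[Pz ->].
  by rewrite andbT; apply: subvP Pz; rewrite /plane addvSl.
have sub2 : X2 \subset X3.
  apply/subsetP=> z; rewrite !inE !(memv_cap _ _ E) => /andP[Pz ->].
  rewrite andbT; apply: subvP Pz.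
  by rewrite /plane -addvA [(<[x]> + _)%VS]addvC addvA addvSl.
have cap12 : X1 :&: X2 = X0.
  apply/setP=> z; rewrite !inE !(memv_cap _ _ E).
  case: (z \in E); rewrite ?andbF ?andbT //.
  apply/andP/idP=> [[/mem_add_lineP[a Pa] /mem_add_lineP[b Pb]]|Pz]; last first.
    by split; apply: subvP Pz; apply: addvSl.
  (* With b nonzero, [b *: y - a *: x] in [Pi] would put [y] in [Pi + <[x]>]. *)
  have [b0|b0] := eqVneq b 0; first by rewrite b0 scale0r subr0 in Pb.
  case/negP: nPy; apply/mem_add_lineP; exists (b^-1 * a).
  rewrite -scalerA -[y in y - _](scalerK b0) -scalerBr memvZ //.
  have -> : b *: y - a *: x = (z - a *: x) - (z - b *: y).
    by rewrite opprB [RHS]addrC addrA subrK.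
  exact: memvB.
have XE : X = X3 :\: (X1 :|: X2).
  apply/setP=> z; rewrite !inE !(memv_cap _ _ E).
  by case: (z \in E); case: (z \in plane x y);
     case: (z \in (Pi + <[x]>)%VS); case: (z \in (Pi + <[y]>)%VS).
have sub3 : X1 :|: X2 \subset X3 by rewrite subUset sub1.
have := cardsUI X1 X2; rewrite cap12 => cU.
have := cardsID (X1 :|: X2) X3; rewrite (setIidPr sub3) -XE.
move: c0 c1 c2 c3; rewrite !card_add_line //.
have cs U : #|[set z in U]| = #|U| by apply: eq_card => z; rewrite inE.
rewrite -/E -!cs -/X0 -/X1 -/X2 -/X3 farE => c0 c1 c2 c3 cX.
(* The cardinals of [X0], [X1] and [X2] are known only after multiplication by q^2, so
   inclusion-exclusion is scaled before substituting them. *)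
have e1 : (q * (q * (#|X1 :|: X2| + #|X0|)) = q * (q * (#|X1| + #|X2|)))%N.
  by rewrite cU.
have e2 : (q * (q * (#|X1 :|: X2| + #|X|)) = q * (q * #|X3|))%N by rewrite cX.
rewrite !mulnDr c0 c1 c2 in e1; rewrite !mulnDr c3 in e2.
have e3 : (q * (q * #|X|) + 2 * (q * #|[set z in Pi]|) =
           q * (q * #|[set z in Pi]|) + #|[set z in Pi]|)%N by lia.
move/(congr1 (muln q)): e3; rewrite !mulnDr !expnS expn0 !muln1 -!mulnA; lia.
Qed.

End Generator.

(** * Neighbour counts in the complement of a graph *)

Lemma card_compl_common_nbrs (V : finType) (e : rel V) x y :
    symmetric e -> irreflexive e -> x != y ->
  (#|[set z | ((x != z) && ~~ e x z) && ((y != z) && ~~ e y z)]| +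
     #|[set z | e x z]| + #|[set z | e y z]| + 2 =
   #|V| + #|[set z | e x z && e y z]| + 2 * e x y)%N.
Proof.
(* [X] and [Y] are the closed neighbourhoods; the common neighbours in the complementary graph are
   the vertices outside their union. *)
move=> esym eirr nxy; pose X := x |: [set z | e x z]; pose Y := y |: [set z | e y z].
have -> : [set z | ((x != z) && ~~ e x z) && ((y != z) && ~~ e y z)] = ~: (X :|: Y).
  by apply/setP=> z; rewrite !inE !negb_or ![z == _]eq_sym.
have cX : #|X| = #|[set z | e x z]|.+1 by rewrite cardsU1 inE eirr.
have cY : #|Y| = #|[set z | e y z]|.+1 by rewrite cardsU1 inE eirr.
(* The vertices x and y themselves lie in both closed neighbourhoods exactly when they are
   adjacent. *)
have cXY : #|X :&: Y| = (#|[set z | e x z && e y z]| + 2 * e x y)%N.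
  case: (boolP (e x y)) => exy; last first.
    rewrite addn0; apply: eq_card => z; rewrite !inE.
    case: eqVneq => [->|_]; last case: eqVneq => [->|_] //.
      by rewrite (negPf nxy) eirr esym (negPf exy).
    by rewrite (negPf exy).
  have -> : X :&: Y = x |: (y |: [set z | e x z && e y z]).
    apply/setP=> z; rewrite !inE; case: eqVneq => [->|_] /=.
      by rewrite esym exy orbT.
    by case: eqVneq => [->|_]; rewrite ?exy.
  by rewrite !cardsU1 !inE eirr (negPf nxy) !eirr andbF; lia.
by have := cardsUI X Y; have := cardsC (X :|: Y); lia.
Qed.

Lemma card_compl_nbrs (V : finType) (e : rel V) x : irreflexive e ->
  (#|[set z | (x != z) && ~~ e x z]| + #|[set z | e x z]|.+1 = #|V|)%N.
Proof.
move=> eirr; rewrite -(cardsC (x |: [set z | e x z])) cardsU1 inE eirr addnC.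
by congr (_ + _)%N; apply: eq_card => z; rewrite !inE negb_or eq_sym.
Qed.

(** * Spanning vectors of projective points *)

Section Lines.
Variables (F : finFieldType) (vT : vectType F).
Implicit Types (P : {vspace vT}) (x : vT).

Lemma vline_dim1 P x : \dim P = 1%N -> x \in P -> x != 0 -> <[x]>%VS = P.
Proof. by move=> dP Px x0; apply/eqP; rewrite eqEdim -memvE Px dim_vline x0 dP. Qed.

Lemma vpick_dim1 P : \dim P = 1%N -> vpick P != 0.
Proof. by move=> dP; rewrite vpick0 -dimv_eq0 dP. Qed.

Lemma vline_vpick P : \dim P = 1%N -> <[vpick P]>%VS = P.
Proof. by move=> dP; apply: vline_dim1 (memv_pick _) (vpick_dim1 dP). Qed.

Lemma vlineZ_vpick x : x != 0 -> exists2 k, k != 0 & vpick <[x]>%VS = k *: x.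
Proof.
move=> x0; have /vlineP[k kE] := memv_pick <[x]>%VS; exists k => //.
have : vpick <[x]>%VS != 0 by rewrite vpick_dim1 // dim_vline x0.
by apply: contraNneq => k0; rewrite kE k0 scale0r.
Qed.

End Lines.

(** * Translation of points, lines and adjacency into vectors *)

Section Bridge.
Variables (F : finFieldType) (N : nat) (A : 'M[F]_N) (Pi : {vspace 'rV[F]_N}).
Implicit Types (x y z u : 'rV[F]_N) (U P L : {vspace 'rV[F]_N}).
Local Notation Q := (qform A).
Local Notation B := (polar A).
Local Notation q := #|F|.
Local Notation outer := (outer A Pi).
Local Notation far := (far A Pi).

Lemma card_lines (D : {set {vspace 'rV[F]_N}}) (S : {set 'rV[F]_N}) :
    {in D, forall P, \dim P = 1%N} ->
    (forall x, (x \in S) = (x != 0) && (<[x]>%VS \in D)) ->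
  #|S| = (#|D| * q.-1)%N.
Proof.
move=> dimD memS.
rewrite -sum1_card (partition_big (fun x => <[x]>%VS) (mem D)) /=; last first.
  by move=> x; rewrite memS => /andP[].
rewrite -sum_nat_const; apply: eq_bigr => P DP.
rewrite sum1dep_card; have := card_vspace P; rewrite (dimD P DP) expn1 => <-.
rewrite [in RHS](cardD1 0) mem0v /=; apply: eq_card => x; rewrite !inE memS.
apply/andP/andP => [[/andP[x0 _] /eqP <-]|[x0 Px]]; first by rewrite memv_line.
by rewrite (vline_dim1 (dimD P DP)) // x0 DP.
Qed.

Lemma quadric_line x : x != 0 -> (<[x]>%VS \in quadric A) = (Q x == 0).
Proof.
move=> x0; rewrite !inE dim_vline x0 subvf /=.
apply/forall_inP/eqP => [/(_ x (memv_line x))/eqP //|Qx _ /vlineP[k ->]].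
by rewrite qformZ Qx mulr0.
Qed.

Lemma containedP U : reflect {in U, forall u, Q u = 0} (contained A U).
Proof.
apply: (iffP subsetP) => [sU u Uu|QU P].
  have [->|u0] := eqVneq u 0; first exact: qform0.
  apply/eqP; rewrite -quadric_line //; apply: sU.
  by rewrite inE dim_vline u0 -memvE.
rewrite !inE => /andP[-> /subvP PU]; rewrite subvf /=.
by apply/forall_inP=> x /PU /QU ->.
Qed.

Lemma vertices_line x : x != 0 -> (<[x]>%VS \in vertices A Pi) = (x \in outer).
Proof.
by move=> x0; rewrite inE quadric_line // !inE dim_vline x0 /= -memvE andbC.
Qed.

Lemma vertices_dim P : P \in vertices A Pi -> \dim P = 1%N.
Proof. by rewrite !inE => /andP[_ /andP[/andP[/eqP]]]. Qed.

(** On the line, Q(ax + by) = ab B(x, y). If [B x y] is nonzero only the two given points are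
    singular; otherwise [x + y] spans a third one. *)
Lemma secant_line x y : x != 0 -> y \notin <[x]>%VS -> Q x = 0 -> Q y = 0 ->
  secant A (<[x]> + <[y]>)%VS = (B x y != 0).
Proof.
move=> x0 nxy Qx Qy; set L := (_ + _)%VS.
have y0 : y != 0 by apply: contraNneq nxy => ->; rewrite mem0v.
have nyx : <[x]>%VS != <[y]>%VS by apply: contraNneq nxy => ->; apply: memv_line.
have Lx : x \in L by apply: subvP (memv_line x); apply: addvSl.
have Ly : y \in L by apply: subvP (memv_line y); apply: addvSr.
have mem_qL z : z != 0 -> z \in L -> Q z = 0 -> <[z]>%VS \in quadric A :&: points L.
  by move=> z0 Lz Qz; rewrite inE quadric_line // Qz eqxx inE dim_vline z0 -memvE.
have sub2 : [set <[x]>%VS; <[y]>%VS] \subset quadric A :&: points L.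
  by apply/subsetP=> P /set2P[]->; apply: mem_qL.
apply/idP/idP => [/eqP c2|Bxy].
  apply/eqP => Bxy; have xy0 : x + y != 0.
    apply: contraNneq nxy => /eqP; rewrite addrC addr_eq0 => /eqP->.
    by rewrite memvN memv_line.
  have : <[x + y]>%VS \in [set <[x]>%VS; <[y]>%VS].
    have /eqP -> : [set <[x]>%VS; <[y]>%VS] == quadric A :&: points L.
      by rewrite eqEcard sub2 c2 cards2 nyx.
    by apply: mem_qL; rewrite ?memvD // qformD Qx Qy Bxy !addr0.
  case/set2P => /vspaceP/(_ (x + y)); rewrite memv_line => /esym.
    by rewrite (rpredDl _ (memv_line x)) (negPf nxy).
  rewrite (rpredDr _ (memv_line y)) => /vlineP[k xE].
  case/negP: nxy; apply/vlineP; exists k^-1; rewrite xE scalerA mulVf ?scale1r //.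
  by apply: contraNneq x0 => k0; rewrite xE k0 scale0r.
rewrite /secant; suff -> : quadric A :&: points L = [set <[x]>%VS; <[y]>%VS].
  by rewrite cards2 nyx.
apply/eqP; rewrite eq_sym eqEsubset sub2; apply/subsetP=> P.
rewrite inE => /andP[qP]; rewrite inE => /andP[/eqP dP PL].
have p0 := vpick_dim1 dP; move: qP PL; rewrite -(vline_vpick dP).
rewrite quadric_line // => /eqP; rewrite -memvE => Qp /memv_addP[_ /vlineP[a ->]].
case=> _ /vlineP[b ->] pE; move: Qp p0; rewrite pE.
rewrite qformD !qformZ Qx Qy !mulr0 !add0r polarZl polarZr => /eqP.
rewrite !mulf_eq0 (negPf Bxy) orbF => /orP[]/eqP ->; rewrite scale0r.
  rewrite add0r => by0; apply/set2P; right; apply: vline_dim1 => //.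
    by rewrite dim_vline y0.
  by rewrite memvZ ?memv_line.
rewrite addr0 => ax0; apply/set2P; left; apply: vline_dim1 => //.
  by rewrite dim_vline x0.
by rewrite memvZ ?memv_line.
Qed.

(** As [x] is not in [Pi], the intersection has dimension at most one. It is nonzero exactly when
    some ax + by with b nonzero lies in [Pi]. *)
Lemma dim_line_meet x y : x \notin Pi -> y \notin <[x]>%VS ->
  (\dim ((<[x]> + <[y]>) :&: Pi)%VS == 1%N) = (y \in (Pi + <[x]>)%VS).
Proof.
move=> nPx nxy; set L := (_ + _)%VS.
have Lx : x \in L by apply: subvP (memv_line x); apply: addvSl.
have Ly : y \in L by apply: subvP (memv_line y); apply: addvSr.
apply/idP/idP => [/eqP dLP|/mem_add_lineP[k Pp]]; last first.
  rewrite eqn_leq; apply/andP; split; last first.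
    rewrite lt0n dimv_eq0 -vpick0; apply/negP => /eqP p0.
    have : y - k *: x \in (L :&: Pi)%VS by rewrite memv_cap Pp memvB ?memvZ.
    move: p0 => /eqP; rewrite vpick0 => /eqP ->; rewrite memv0 subr_eq0 => /eqP yE.
    by rewrite yE memvZ ?memv_line in nxy.
  rewrite -ltnS (leq_trans (n := \dim L)) //; last first.
    by rewrite (leq_trans (dimv_add_leqif _ _)) // !dim_vline; do 2 case: eqP.
  have := dimvS (capvSl L Pi); rewrite leq_eqVlt => /orP[/eqP dE|//].
  have /eqP LE : (L :&: Pi)%VS == L by rewrite eqEdim capvSl dE /=.
  by rewrite -LE memv_cap (negPf nPx) andbF in Lx.
have := memv_pick (L :&: Pi)%VS; have := vpick_dim1 dLP; set v := vpick _ => v0.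
rewrite memv_cap => /andP[/memv_addP[_ /vlineP[a ->] [_ /vlineP[b ->] vE]] Pv].
have b0 : b != 0.
  apply: contraNneq nPx => b0; rewrite b0 scale0r addr0 in vE.
  have a0 : a != 0 by apply: contraNneq v0 => a0; rewrite vE a0 scale0r.
  by rewrite -(scalerK a0 x) -vE memvZ.
rewrite -(scalerK b0 y) memvZ //; apply/mem_add_lineP; exists (- a).
by rewrite scaleNr opprK addrC -vE.
Qed.

Lemma contained_line x y : Q x = 0 -> Q y = 0 -> B x y = 0 ->
  contained A (<[x]> + <[y]>)%VS.
Proof.
move=> Qx Qy Bxy; apply/containedP=> z /memv_addP[_ /vlineP[a ->] [_ /vlineP[b ->] ->]].
by rewrite qformD !qformZ polarZl polarZr Qx Qy Bxy !mulr0 !addr0.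
Qed.

Lemma outer_neq0 x : x \in outer -> x != 0.
Proof. by rewrite inE => /andP[_]; apply: contraNneq => ->; apply: mem0v. Qed.

Lemma outerZ k x : k != 0 -> (k *: x \in outer) = (x \in outer).
Proof.
by move=> k0; rewrite !inE qformZ !mulf_eq0 !(negPf k0) /= rpredZeq (negPf k0).
Qed.

Lemma farZ k x z : k != 0 -> (k *: z \in far x) = (z \in far x).
Proof.
move=> k0; rewrite !inE qformZ polarZr !mulf_eq0 (negPf k0) /=.
by rewrite rpredZeq (negPf k0).
Qed.

Lemma far_outer x : far x \subset outer.
Proof.
apply/subsetP=> z; rewrite !inE => /and3P[-> _]; apply: contra.
exact/subvP/addvSl.
Qed.

Local Notation vertex := {P | P \in vertices A Pi}.

Definition vertex_vec (P : vertex) := vpick (val P).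

Lemma vertex_vecK (P : vertex) : <[vertex_vec P]>%VS = val P.
Proof. exact: vline_vpick (vertices_dim (valP P)). Qed.

Lemma vertex_vec_outer (P : vertex) : vertex_vec P \in outer.
Proof.
rewrite -vertices_line ?vertex_vecK ?(valP P) //.
exact: vpick_dim1 (vertices_dim (valP P)).
Qed.

Lemma vertex_vec_neq (P R : vertex) :
  (P != R) = (vertex_vec R \notin <[vertex_vec P]>%VS).
Proof.
congr negb; apply/eqP/idP => [->|Rx]; first exact: memv_line.
apply/val_inj; rewrite -vertex_vecK -[RHS]vertex_vecK; apply/esym.
apply: vline_dim1 Rx (outer_neq0 (vertex_vec_outer R)).
by rewrite dim_vline outer_neq0 ?vertex_vec_outer.
Qed.

(** If the polar form is nonzero on the pair, the line is secant. If it vanishes, the line is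
    contained in the quadric, and adjacency amounts to meeting [Pi]. *)
Lemma adjE (P R : vertex) :
  adj A Pi P R = (P != R) && (vertex_vec R \notin far (vertex_vec P)).
Proof.
rewrite /adj -!vertex_vecK; case: (boolP (P != R)) => //=.
rewrite vertex_vec_neq; set x := vertex_vec P; set y := vertex_vec R => nxy.
have ox : x \in outer := vertex_vec_outer P.
have /setIdP[/eqP Qx nPx] := ox.
have /setIdP[/eqP Qy _] := vertex_vec_outer R.
rewrite secant_line ?(outer_neq0 ox) // dim_line_meet // inE Qy eqxx /=.
by case: eqVneq => //= Bxy; rewrite contained_line // negbK.
Qed.

(** Invariance of [S] under scaling makes membership independent of the representative picked on
    each point, and each point carries q - 1 nonzero vectors. *)
Lemma card_vertex_vec (S : {set 'rV[F]_N}) : S \subset outer ->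
    (forall k x, k != 0 -> (k *: x \in S) = (x \in S)) ->
  (#|[set P | vertex_vec P \in S]| * q.-1 = #|S|)%N.
Proof.
move=> /subsetP So SZ; rewrite -(card_imset _ val_inj); apply/esym/card_lines.
  by move=> _ /imsetP[P _ ->]; apply: vertices_dim (valP P).
move=> x; apply/idP/idP => [Sx|/andP[x0 /imsetP[P]]].
  have x0 := outer_neq0 (So x Sx); rewrite x0 /=.
  have Vx : <[x]>%VS \in vertices A Pi by rewrite vertices_line ?So.
  apply/imsetP; exists (Sub <[x]>%VS Vx : vertex); last by rewrite SubK.
  rewrite inE /vertex_vec SubK; have [k k0 ->] := vlineZ_vpick x0.
  by rewrite SZ.
rewrite inE /vertex_vec => SP PE; move: SP; rewrite -PE.
by have [k k0 ->] := vlineZ_vpick x0; rewrite SZ.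
Qed.

Lemma far_sym x y : x \in outer -> (y \in far x) -> (x \in far y).
Proof.
rewrite !inE => /andP[Qx nPx] /and3P[Qy Bxy nPy]; rewrite Qx polarC Bxy /=.
by apply: contra nPy; apply: mem_add_lineC.
Qed.

(** A vector of [Pi] in the radical of [B] is singular, hence zero by nondegeneracy. So [Pi] imposes
    [\dim Pi] independent conditions, and its orthogonal, which contains [Pi], has the same
    dimension as [Pi]. *)
Lemma perp_sub_generator : nondegenerate_quadric A -> N = (2 * \dim Pi)%N ->
  {in Pi, forall u, Q u = 0} -> perp_sub A Pi Pi.
Proof.
move=> nd dN singPi; set d := \dim Pi in dN.
pose b := vbasis Pi; pose M : 'M[F]_(d, N) := \matrix_(i < d) b`_i.
have ME (u : 'rV_d) : u *m M = \sum_i u 0 i *: b`_i.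
  by rewrite mulmx_sum_row; apply: eq_bigr => i _; rewrite rowK.
have PM (u : 'rV_d) : u *m M \in Pi.
  rewrite ME memv_suml // => i _; rewrite memvZ // vbasis_mem //.
  by rewrite mem_nth // size_tuple.
have Minj (u : 'rV_d) : u *m M = 0 -> u = 0.
  rewrite ME => u0; apply/rowP=> i; rewrite mxE.
  by rewrite -(coord_sum_free (u 0) i (basis_free (vbasisP Pi))) u0 linear0.
have MGinj (u : 'rV_d) : u *m (M *m (A + A^T)) = 0 -> u = 0.
  move=> u0; apply: Minj; apply: nd; first exact: singPi.
  by move=> y; rewrite polarE -(mulmxA u) u0 mul0mx mxE.
(* The rows of [M] form a basis of [Pi], so the left kernel of [C] is the orthogonal of [Pi]. *)
pose C := (A + A^T) *m M^T.
have rC : \rank C = d.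
  rewrite -mxrank_tr trmx_mul trmxK linearD /= trmxK [A^T + A]addrC.
  exact/eqP/inj_row_free.
have rM : \rank M = d by apply/eqP/inj_row_free.
have MC : (M <= kermx C)%MS.
  apply/sub_kermxP/row_matrixP => i; rewrite row_mul row0.
  apply/rowP=> j; rewrite [RHS]mxE.
  have -> : (row i M *m C) 0 j = B (row i M) (row j M).
    by rewrite polarE /C mulmxA !mxE; apply: eq_bigr => k _; rewrite !mxE.
  by apply: (polar_Pi singPi); rewrite rowE; apply: PM.
have CM : (kermx C <= M)%MS.
  by rewrite -(mxrank_leqif_sup MC) mxrank_ker rC rM dN mul2n -addnn addnK.
move=> z zP; have : (z <= kermx C)%MS.
  apply/sub_kermxP/rowP => j; rewrite [RHS]mxE.
  have -> : (z *m C) 0 j = B z (row j M).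
    by rewrite polarE /C mulmxA !mxE; apply: eq_bigr => k _; rewrite !mxE.
  by apply: zP; rewrite rowE; apply: PM.
by move/submx_trans/(_ CM)/submxP => [u ->]; apply: PM.
Qed.

End Bridge.

Theorem theorem3p1 (F : finFieldType) (q n : nat)
    (hq : #|F| = q) (hn : (1 <= n)%N)
    (A : 'M[F]_(2 * n + 2)) (hA : hyperbolic A)
    (Pi : {vspace 'rV[F]_(2 * n + 2)}) (hPi : quadric_generator A Pi) :
  strongly_regular (adj A Pi)
    ((q ^ n * (q ^ n.+1 - 1)) %/ (q - 1))%N
    (q ^ (2 * n) - 1)%N
    (q ^ (2 * n - 1) * (q - 1) - 2)%N
    ((q ^ (2 * n - 1) + q ^ (n - 1)) * (q - 1))%N.
Proof.
have [nd [U [contU maxU] dU]] := hA; have [/containedP singPi maxPi] := hPi.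
have dPi : \dim Pi = n.+1.
  by apply/eqP; rewrite eqn_leq -{1}dU maxU ?(proj1 hPi) // -dU maxPi.
have perpPi : perp_sub A Pi Pi.
  by apply: perp_sub_generator => //; rewrite dPi mulnS addnC.
(* A vector of the radical is orthogonal to [Pi], so it lies in [Pi] and is singular; nondegeneracy
   then applies in every characteristic. *)
have perpV : perp_sub A fullv 0%VS.
  move=> z zV; rewrite memv0; apply/eqP/nd => [|y]; last by apply: zV; rewrite memvf.
  by apply/singPi/perpPi => u _; apply: zV; rewrite memvf.
pose vec := @vertex_vec F _ A Pi.
have vecP P : [/\ vec P \in outer A Pi, vec P \notin Pi & qform A (vec P) = 0].
  have oP : vec P \in outer A Pi := vertex_vec_outer P.
  by split=> //; move: oP; rewrite inE => /andP[/eqP].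
(* [e] is non-adjacency of distinct vertices, the complementary graph that is counted first. *)
pose e : rel {P | P \in vertices A Pi} :=
  fun P R => vec R \in far A Pi (vec P).
have adjE' P R : adj A Pi P R = (P != R) && ~~ e P R by rewrite adjE.
have esym : symmetric e.
  by move=> P R; apply/idP/idP; apply: far_sym; case: (vecP P); case: (vecP R).
have eirr : irreflexive e.
  by move=> P; rewrite /e !inE (subvP (addvSr _ _)) ?memv_line ?andbF.
have q_gt1 : (1 < q)%N by rewrite -hq finNzRing_gt1.
have [m nE] : exists m, n = m.+1 by exists n.-1; rewrite prednK.
have [r qE] : exists r, q = r.+2 by exists q.-2; lia.
(* With a = q^(n-1), all powers become monomials in a and q, and the counts below are stated as
   additive identities free of truncated subtraction. *)
have [a aE] : exists a, (q ^ m)%N = a by eexists.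
have qn1 : (q ^ n.+1 = a * q * q)%N by rewrite nE !expnSr aE.
have qn : (q ^ n = a * q)%N by rewrite nE !expnSr aE.
have q2n1 : (q ^ (2 * n - 1) = a * a * q)%N.
  by rewrite -aE -expnD -expnSr; congr (_ ^ _)%N; lia.
have q2n : (q ^ (2 * n) = a * a * q * q)%N.
  by rewrite -aE -expnD -!expnSr; congr (_ ^ _)%N; lia.
have qn_1 : (q ^ (n - 1) = a)%N by rewrite -aE nE subn1.
have cV : #|{: 'rV[F]_(2 * n + 2)}%VS| = (a * a * q * q * q * q)%N.
  rewrite card_vspace dimvf /dim /= mul1n hq -aE -expnD -!expnSr.
  by congr (_ ^ _)%N; lia.
have cPi : #|Pi| = (a * q * q)%N by rewrite card_vspace hq dPi qn1.
have mulqI X Y : (q * X = q * Y)%N -> X = Y.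
  by move/eqP; rewrite eqn_pmul2l ?(ltnW q_gt1) // => /eqP.
have mulqpI X Y : (X * q.-1 = Y * q.-1)%N -> X = Y.
  by move/eqP; rewrite eqn_pmul2r ?qE // => /eqP.
have [W WE] : exists W, #|{: {P | P \in vertices A Pi}}| = W by eexists.
have cW : (W * q.-1 + a * q = a * a * q * q * q)%N.
  apply: (mulqI _ _); have := card_outer singPi perpPi; rewrite cV cPi hq.
  rewrite -(card_vertex_vec (A := A) (Pi := Pi)) //; last by move=> k x; apply: outerZ.
  have -> : #|[set P | @vertex_vec F _ A Pi P \in outer A Pi]| = W.
    by rewrite -WE; apply: eq_card => P; rewrite inE; have [] := vecP P.
  by rewrite hq; clear; lia.
have cf P : (#|[set R | e P R]| * q.-1 + a * q = a * a * q * q)%N.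
  have [oP nP QP] := vecP P.
  do 2!apply: (mulqI _ _); have := card_far singPi perpPi perpV nP QP.
  rewrite cV cPi hq.
  rewrite -(card_vertex_vec (A := A) (Pi := Pi)) ?far_outer //; last first.
    by move=> k x; apply: farZ.
  by rewrite hq -[#|[set R | _]|]/(#|[set R | e P R]|); lia.
have cc P R : (#|[set S | e P S && e R S]| * q.-1 =
               #|far A Pi (vec P) :&: far A Pi (vec R)|)%N.
  rewrite -hq -(card_vertex_vec (A := A) (Pi := Pi)); first last.
  - by move=> k x k0; rewrite !in_setI !farZ.
  - by apply: subset_trans (subsetIl _ _) (far_outer _ _ _).
  by congr (_ * _)%N; apply: eq_card => S; rewrite !inE /e !inE.
(* An adjacent pair is either collinear through a point of [Pi] or has nonzero polar form; both
   cases give the same count. *)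
have cadj P R : P != R -> ~~ e P R ->
    (#|[set S | e P S && e R S]| * q.-1 + a * q = a * a * q)%N.
  move=> nPR nePR; have [oP nP QP] := vecP P; have [oR nR QR] := vecP R.
  rewrite cc; do 3!apply: (mulqI _ _).
  have := nPR; rewrite vertex_vec_neq => nRP.
  have : (q * (q * (q * #|far A Pi (vec P) :&: far A Pi (vec R)| + #|Pi|)) =
          #|{: 'rV[F]_(2 * n + 2)}%VS|)%N.
    rewrite -hq; have [RP|RP] := boolP (vec R \in (Pi + <[vec P]>)%VS).
      apply: card_far_collinear => //; have /mem_add_lineP[k Pk] := RP.
      (* Singularity of R - kP in [Pi] gives k B(P, R) = 0, and k is nonzero because R is outside
         [Pi]. *)
      have := singPi _ Pk; rewrite -scaleNr qformD qformZ QP QR polarZr polarC.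
      rewrite mulr0 !add0r => /eqP; rewrite mulf_eq0 oppr_eq0.
      case/orP => /eqP // k0; case/negP: nR.
      by rewrite k0 scale0r subr0 in Pk.
    apply: card_far_opposite => //; apply: contra nePR => BPR.
    by rewrite /e inE QR eqxx BPR.
  by rewrite cV cPi; clear; lia.
have cnadj P R : e P R ->
    (#|[set S | e P S && e R S]| * q.-1 + 3 * a * q = a * a * q + a * q * q + a)%N.
  move=> ePR; have [oP nP QP] := vecP P; have [oR nR QR] := vecP R.
  have := ePR; rewrite /e inE => /and3P[_ /eqP BPR RP].
  rewrite cc; do 3!apply: (mulqI _ _).
  have := card_far_tangent singPi perpPi perpV nP RP QP QR BPR.
  by rewrite cV cPi hq !expnS expn0; clear; lia.
have cW' : (q ^ n * (q ^ n.+1 - 1) = W * (q - 1))%N.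
  rewrite qn qn1 [LHS]mulnBr muln1 subn1 -(addnK (a * q) (W * q.-1))%N cW !mulnA.
  by rewrite [(a * q * a)%N]mulnAC.
have cN P R : P != R ->
    (#|[set S | ((P != S) && ~~ e P S) && ((R != S) && ~~ e R S)]| +
       #|[set S | e P S]| + #|[set S | e R S]| + 2 =
     W + #|[set S | e P S && e R S]| + 2 * e P R)%N.
  by rewrite -WE; apply: card_compl_common_nbrs.
have nbrs2 P R : [set S | adj A Pi P S && adj A Pi R S] =
    [set S | ((P != S) && ~~ e P S) && ((R != S) && ~~ e R S)].
  by apply/setP=> S; rewrite !inE !adjE'.
(* After multiplication by q - 1 the counts combine to M + 2 = a^2 q (q - 1), so the truncated
   subtraction of 2 is exact. *)
have adj_count f g c M : (f * q.-1 + a * q = a * a * q * q)%N ->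
    (g * q.-1 + a * q = a * a * q * q)%N -> (c * q.-1 + a * q = a * a * q)%N ->
    (M + f + g + 2 = W + c + 2 * false)%N -> M = (a * a * q * (q - 1) - 2)%N.
  move=> cf' cg cc' /(congr1 (muln^~ q.-1)); rewrite !mulnDl => cM.
  apply: mulqpI; rewrite mulnBl subn1; move: cW cf' cg cc' cM.
  by rewrite qE /=; clear; lia.
have nadj_count f g c M : (f * q.-1 + a * q = a * a * q * q)%N ->
    (g * q.-1 + a * q = a * a * q * q)%N ->
    (c * q.-1 + 3 * a * q = a * a * q + a * q * q + a)%N ->
    (M + f + g + 2 = W + c + 2 * true)%N -> M = ((a * a * q + a) * (q - 1))%N.
  move=> cf' cg cc' /(congr1 (muln^~ q.-1)); rewrite !mulnDl => cM.
  apply: mulqpI; rewrite subn1; move: cW cf' cg cc' cM.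
  by rewrite qE /=; clear; lia.
split.
- split=> [P R|P]; first by rewrite !adjE' esym eq_sym.
  by rewrite adjE' eqxx.
- by rewrite cW' mulnK ?subn_gt0.
- move=> P; have := etrans (card_compl_nbrs P eirr) WE; have := cf P.
  have -> : [set R | adj A Pi P R] = [set R | (P != R) && ~~ e P R].
    by apply/setP=> R; rewrite !inE adjE'.
  rewrite q2n => cfP cNP; apply: mulqpI; rewrite mulnBl.
  rewrite -cNP qE /= in cW; rewrite qE /= in cfP *.
  by lia.
- move=> P R; rewrite adjE' => /andP[nPR nePR]; rewrite q2n1 nbrs2.
  apply: (adj_count _ _ _ _ (cf P) (cf R) (cadj P R nPR nePR)).
  by have := cN P R nPR; rewrite (negPf nePR).
move=> P R nPR; rewrite adjE' nPR /= negbK => ePR; rewrite q2n1 qn_1 nbrs2.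
apply: (nadj_count _ _ _ _ (cf P) (cf R) (cnadj P R ePR)).
by have := cN P R nPR; rewrite ePR.
Qed.
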